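(* Let $w$ be a multilinear commutator word and let $G$ be a profinite group having only countably many $w$-values. Then the verbal subgroup $w(G)$ is finite.
   Context: For a group word $w=w(x_1,\dots,x_n)$ and a group $G$, a $w$-value in $G$ is an element of the form $w(g_1,\dots,g_n)$ with $g_1,\dots,g_n\in G$. In a profinite group $G$, the verbal subgroup $w(G)$ is the closed subgroup (topologically) generated by all $w$-values. Commutators are $[x,y]=x^{-1}y^{-1}xy$. A multilinear commutator word (also called an outer commutator word) is a word obtained by nesting commutators but always using different variables: a single variable $x_i$ is a multilinear commutator word, and if $u$ and $v$ are multilinear commutator words involving disjoint sets of variables, then $[u,v]$ is a multilinear commutator word. For example, $[[x_1,x_2],[x_3,x_4,x_5],x_6]$ is one (with $[a_1,\dots,a_k]=[[a_1,\dots,a_{k-1}],a_k]$), while $[x_1,x_2,x_2,x_2]$ is not. ''Countably many'' means finite or countably infinite in number. *)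

(* Defs.v *)
From HB Require Import structures.
From mathcomp Require Import all_boot.
From mathcomp Require Import all_classical.
From mathcomp Require Import topology.

Set Implicit Arguments.
Unset Strict Implicit.
Unset Printing Implicit Defensive.

Local Open Scope classical_set_scope.
Local Open Scope group_scope.

HB.mixin Record isTopologicalGroup G of Topological G & Group G := {
  mulg_continuous : continuous (fun xy : G * G => xy.1 * xy.2 : G) ;
  invg_continuous : continuous (fun x : G => x^-1 : G)
}.

#[short(type="topologicalGroupType")]
HB.structure Definition TopologicalGroup :=
  {G of Topological G & Group G & isTopologicalGroup G}.

Definition profinite (G : topologicalGroupType) : Prop :=
  [/\ compact [set: G], hausdorff_space G & totally_disconnected [set: G]].

Section Words.
Variable n : nat.

(* The letter (i, false) stands for the variable x_i, and (i, true) for its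
   inverse. Words are not required to be reduced; multilinear commutator words
   (below) always are. *)
Definition word := seq ('I_n * bool).

Definition word_var (i : 'I_n) : word := [:: (i, false)].

Definition word_inv (u : word) : word := [seq (x.1, ~~ x.2) | x <- rev u].

Definition word_comm (u v : word) : word := word_inv u ++ word_inv v ++ u ++ v.

Definition involves (u : word) (i : 'I_n) : bool := i \in [seq x.1 | x <- u].

Inductive multilinear_commutator : word -> Prop :=
| MultilinearVar i : multilinear_commutator (word_var i)
| MultilinearComm u v :
    multilinear_commutator u -> multilinear_commutator v ->
    (forall i, involves u i -> ~~ involves v i) ->
    multilinear_commutator (word_comm u v).

Definition word_eval (G : groupType) (w : word) (g : 'I_n -> G) : G :=
  \prod_(x <- w) (if x.2 then (g x.1)^-1 else g x.1).

Definition word_values (G : groupType) (w : word) : set G :=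
  range (word_eval (G := G) w).

End Words.

Arguments word_values {n} G w.

Definition closed_subgroup (G : topologicalGroupType) (H : set G) : Prop :=
  closed H /\ group_closed (in_set H).

Definition verbal_subgroup (G : topologicalGroupType) n (w : word n) : set G :=
  smallest (@closed_subgroup G) (word_values G w).

Arguments verbal_subgroup G {n} w.

(* Main.v *)
(* Let [K] be normal in [G]. If [w] is constant on a product of cosets of [K],
   then, expanding commutators, every [w(y)] with [y_i] in [K] for [i] in a
   nonempty set [I] of letters, and the other [y_i] suitable conjugates of coset
   representatives, is trivial. The Baire category theorem provides such products
   of cosets inside any product of open cosets; descending induction on [I] then
   yields an open normal subgroup [H] such that [w(y) = 1] as soon as one [y_i]
   lies in [H]. So [w(y)] only depends on the [y_i] modulo [H], there are finitely
   many values, and [H] centralises [W = w(G)].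

   By Schur's theorem [[W, W]] is finite. Some term [G^(d)] of the derived series
   lies in [W], so [G^(d+1)] is finite. One shows by descending induction on
   [k_1, ..., k_n] that the values [w(y)] with [y_i] in [G^(k_i)] lie in a finite
   normal subgroup: modulo the one obtained for larger tuples, [w] is
   multiplicative in a letter [i] with [k_i] maximal, so that
   [w(y)^m = w(.., y_i^m, ..) = 1] when [m] is an exponent of [G/H], and
   Dietzmann's lemma applies. *)
Require Import Defs.
From mathcomp Require Import all_boot all_classical topology.

Set Implicit Arguments.
Unset Strict Implicit.
Unset Printing Implicit Defensive.

Local Open Scope classical_set_scope.
Local Open Scope group_scope.

Ltac group_norm :=
  rewrite /commg /conjg ?invgM ?invgK ?mulgA ?mul1g ?mulg1;
  repeat progress rewrite ?mulgK ?mulgVK ?mulVg ?mulgV ?mul1g ?mulg1.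

(** * Subgroups normalised by a set, and commutators of their closures *)

Section Subgroups.
Variable G : groupType.
Implicit Types (x y k : G) (K N X Y Q : set G).

Record normalized_subgroup K N : Prop := NormalizedSubgroup {
  nsub1 : N 1;
  nsubM : forall x y, N x -> N y -> N (x * y);
  nsubV : forall x, N x -> N x^-1;
  nsubJ : forall x k, N x -> K k -> N (x ^ k) }.

Definition normal N := normalized_subgroup [set: G] N.

Lemma normalJ N x y : normal N -> N x -> N (x ^ y).
Proof. by move=> nN Nx; apply: (nsubJ nN). Qed.

Lemma normal_normalized K N : normal N -> normalized_subgroup K N.
Proof. by move=> nN; case: (nN) => *; split=> // *; apply: normalJ. Qed.

Lemma normal1 : normal [set 1].
Proof.
by split=> [|x y -> ->|x ->|x k -> _]; rewrite ?mulg1 ?invg1 ?conj1g.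
Qed.

Lemma normalT : normal [set: G].
Proof. by split. Qed.

Lemma nsubX K N x m : normalized_subgroup K N -> N x -> N (x ^+ m).
Proof.
move=> nN Nx; elim: m => [|m IH]; first by rewrite expg0; apply: nsub1 nN.
by rewrite expgS; apply: (nsubM nN).
Qed.

Lemma nsubVE K N x : normalized_subgroup K N -> N x^-1 <-> N x.
Proof.
move=> nN; split=> [Nx|]; last exact: (nsubV nN).
by rewrite -[x]invgK; apply: (nsubV nN Nx).
Qed.

Lemma normal_comm_sub N x y : normal N -> N x -> N [~ x, y].
Proof.
by move=> nN Nx; apply: (nsubM nN); [apply: (nsubV nN Nx) | apply: normalJ].
Qed.

Lemma nsubI K N N' : normalized_subgroup K N -> normalized_subgroup K N' ->
  normalized_subgroup K (N `&` N').
Proof.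
move=> [? ? ? ?] [? ? ? ?].
by split=> [|? ? [? ?] [? ?]|? [? ?]|? ? [? ?] ?]; split; auto.
Qed.

Lemma conj_normalized K Q m : normal K -> normalized_subgroup K Q ->
  normalized_subgroup K (fun x => Q (x ^ m)).
Proof.
move=> nK nQ; split=> [|x y Qx Qy|x Qx|x k Qx Kk].
- by rewrite conj1g; apply: nsub1 nQ.
- by rewrite conjMg; apply: (nsubM nQ).
- by rewrite conjVg; apply: (nsubV nQ).
- by rewrite conjJg; apply: (nsubJ nQ) => //; apply: normalJ.
Qed.

(** For [K] the whole group this is the normal closure. Smaller [K] occur because the differences of
    values on a product of cosets of [K] are only stable under conjugation by [K]. *)
Definition ncl K X : set G :=
  [set x | forall N, normalized_subgroup K N -> X `<=` N -> N x].

Lemma ncl_normalized K X : normalized_subgroup K (ncl K X).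
Proof.
split=> [N nN _|x y Cx Cy N nN XN|x Cx N nN XN|x k Cx Kk N nN XN].
- exact: nsub1 nN.
- by apply: (nsubM nN); [apply: Cx | apply: Cy].
- by apply: (nsubV nN); apply: Cx.
- by apply: (nsubJ nN) => //; apply: Cx.
Qed.

Lemma sub_ncl K X : X `<=` ncl K X.
Proof. by move=> x Xx N _; apply. Qed.

(** The elements [d] of [K] with [[~ x, d]] in [Q] for all [x] in [X] form a subgroup normalised by
    [K]: commutator identities handle products and inverses, and a conjugation of [d] is moved onto
    [x]. *)
Lemma comm_ncl_r K X Y Q : normal K -> Y `<=` K ->
  (forall x k, X x -> K k -> X (x ^ k)) -> normalized_subgroup K Q ->
  (forall x y, X x -> Y y -> Q [~ x, y]) ->
  forall x y, X x -> ncl K Y y -> Q [~ x, y].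
Proof.
move=> nK YK XJ nQ XYQ x y Xx Cy.
suff [_] : (K `&` [set d | forall x, X x -> Q [~ x, d]]) y by apply.
apply: Cy => [|d Yd]; last by split=> [|z Xz]; [apply: YK | apply: XYQ].
split=> [|d e [Kd Qd] [Ke Qe]|d [Kd Qd]|d k [Kd Qd] Kk].
- split=> [|z _ /=]; first exact: nsub1 nK.
  by rewrite commg1; apply: nsub1 nQ.
- split=> [|z Xz /=]; first exact: (nsubM nK).
  have -> : [~ z, d * e] = [~ z, e] * [~ z, d] ^ e by group_norm.
  by apply: (nsubM nQ); [apply: Qe | apply: (nsubJ nQ) => //; apply: Qd].
- split=> [|z Xz /=]; first exact: (nsubV nK).
  have -> : [~ z, d^-1] = ([~ z, d] ^ d^-1)^-1 by group_norm.
  apply: (nsubV nQ); apply: (nsubJ nQ); first exact: Qd.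
  exact: (nsubV nK).
- split=> [|z Xz /=]; first exact: (nsubJ (normal_normalized K nK)).
  have -> : [~ z, d ^ k] = [~ z ^ k^-1, d] ^ k by rewrite conjRg conjgKV.
  apply: (nsubJ nQ) => //; apply: Qd; apply: XJ => //; exact: (nsubV nK).
Qed.

Lemma comm_ncl K X Y Q : normal K -> X `<=` K -> Y `<=` K ->
  (forall x k, X x -> K k -> X (x ^ k)) -> normalized_subgroup K Q ->
  (forall x y, X x -> Y y -> Q [~ x, y]) ->
  forall x y, ncl K X x -> ncl K Y y -> Q [~ x, y].
Proof.
move=> nK XK YK XJ nQ XYQ x y Cx Cy.
rewrite -invgR; apply: (nsubV nQ).
apply: (@comm_ncl_r K (ncl K Y) X) => // [z k Cz Kk|z t Cz Xt].
  exact: (nsubJ (ncl_normalized K Y)).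
rewrite -invgR; apply: (nsubV nQ).
exact: (@comm_ncl_r K X Y).
Qed.

End Subgroups.

(** * Evaluation of words *)

Section WordEvaluation.
Variables (n : nat) (G : groupType).
Implicit Types (u v w : word n) (g h : 'I_n -> G) (S B : 'I_n -> set G).

Lemma eval_var (i : 'I_n) g : word_eval (word_var i) g = g i.
Proof. by rewrite /word_eval big_seq1. Qed.

Lemma eval_inv u g : word_eval (word_inv u) g = (word_eval u g)^-1.
Proof.
rewrite /word_eval /word_inv big_map -[u in RHS]revK -prodgV.
by apply: eq_bigr => -[i []] _ /=; rewrite ?invgK.
Qed.

Lemma eval_comm u v g :
  word_eval (word_comm u v) g = [~ word_eval u g, word_eval v g].
Proof.
rewrite /word_comm /commg /conjg -!eval_inv /word_eval !big_cat /=.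
by rewrite !mulgA.
Qed.

Lemma involves_var (i j : 'I_n) : involves (word_var i) j = (j == i).
Proof. by rewrite /involves /= inE. Qed.

Lemma involves_comm u v i :
  involves (word_comm u v) i = involves u i || involves v i.
Proof.
have inv_inv (t : word n) : involves (word_inv t) i = involves t i.
  by rewrite /involves /word_inv -map_comp map_rev mem_rev; congr (_ \in _).
rewrite -[in RHS](inv_inv u) -[in RHS](inv_inv v) /involves /word_comm.
rewrite !map_cat !mem_cat -!/(involves _ _) !inv_inv.
by case: (involves u i); case: (involves v i).
Qed.

Lemma eq_eval u g h :
  (forall i, involves u i -> g i = h i) -> word_eval u g = word_eval u h.
Proof.
move=> gh; apply: eq_big_seq => x xu; rewrite gh //.
by apply/mapP; exists x.
Qed.

Lemma eval_conj u g y : word_eval u (fun i => g i ^ y) = word_eval u g ^ y.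
Proof.
rewrite /word_eval conjg_prod; apply: eq_bigr => -[i []] _ //=.
by rewrite conjVg.
Qed.

(** When [u] and [v] share no letter, a single assignment thus realises any value of [u] together
    with any value of [v]. *)
Definition splice u g h i := if involves u i then g i else h i.

Lemma splice_l u g h : word_eval u (splice u g h) = word_eval u g.
Proof. by apply: eq_eval => i; rewrite /splice => ->. Qed.

Lemma splice_r u v g h : (forall i, involves u i -> ~~ involves v i) ->
  word_eval v (splice u g h) = word_eval v h.
Proof.
move=> uv; apply: eq_eval => i vi; rewrite /splice.
by case: ifP => // /uv; rewrite vi.
Qed.

Lemma eval_splice u v g h : (forall i, involves u i -> ~~ involves v i) ->
  word_eval (word_comm u v) (splice u g h) = [~ word_eval u g, word_eval v h].
Proof. by move=> uv; rewrite eval_comm splice_l splice_r. Qed.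

Lemma mlc_involves w : multilinear_commutator w -> exists i, involves w i.
Proof.
elim=> [i|u v _ [i ui] _ _ _]; exists i.
  by rewrite involves_var.
by rewrite involves_comm ui.
Qed.

Lemma eval_in_normal w N g i : multilinear_commutator w -> normal N ->
  involves w i -> N (g i) -> N (word_eval w g).
Proof.
move=> mw nN; elim: mw => [j|u v _ IHu _ IHv _].
  by rewrite involves_var eval_var => /eqP ->.
rewrite involves_comm eval_comm => /orP[ui|vi] Ngi.
  by apply: normal_comm_sub => //; apply: IHu.
rewrite -invgR; apply: (nsubV nN).
by apply: normal_comm_sub => //; apply: IHv.
Qed.

Lemma eval_congr w N g h : normal N ->
  (forall i, N (g i / h i)) -> N (word_eval w g / word_eval w h).
Proof.
move=> nN Ngh; rewrite /word_eval; elim: w => [|[i b] w IH].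
  by rewrite !big_nil divg1; apply: nsub1 nN.
rewrite !big_cons /=; set x := \prod_(_ <- w) _; set y := \prod_(_ <- w) _.
set a := if b then _ else _; set c := if b then _ else _.
have -> : a * x / (c * y) = (a / c) * (x / y) ^ c^-1 by group_norm.
apply: (nsubM nN); last exact: normalJ.
rewrite /a /c; case: b {a c} => //; rewrite invgK.
have -> : (g i)^-1 * h i = ((g i / h i)^-1) ^ h i by group_norm.
by apply: normalJ => //; apply: (nsubV nN).
Qed.

End WordEvaluation.

(** * Values with restricted letters, and the derived series *)

Section RestrictedValues.
Variables (n : nat) (G : groupType).
Implicit Types (u v w : word n) (g h x : 'I_n -> G) (S B : 'I_n -> set G).
Implicit Types N A : set G.

Definition upd T (f : 'I_n -> T) i (a : T) j := if j == i then a else f j.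

Lemma upd_same T (f : 'I_n -> T) i a : upd f i a i = a.
Proof. by rewrite /upd eqxx. Qed.

Lemma eval_upd w g i a : ~~ involves w i ->
  word_eval w (upd g i a) = word_eval w g.
Proof.
move=> wi; apply: eq_eval => j wj; rewrite /upd; case: eqP => // ji.
by rewrite -ji wj in wi.
Qed.

Definition restricted_values w S : set G :=
  [set word_eval w x | x in [set x | forall i, S i (x i)]].

Lemma restricted_valuesJ w S y z : (forall i a b, S i a -> S i (a ^ b)) ->
  restricted_values w S y -> restricted_values w S (y ^ z).
Proof.
move=> SJ [x Sx <-]; exists (fun i => x i ^ z); last exact: eval_conj.
by move=> i; apply: SJ.
Qed.

(* The values of [[u, v]] with one letter restricted to [B] generate a normal
   subgroup modulo which the changes of [u] commute with the values of [v]. *)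
Lemma eval_shift w S B N x x' : multilinear_commutator w -> normal N ->
  (forall i a b, S i a -> S i (a ^ b)) ->
  (forall i a b, B i a -> B i (a ^ b)) ->
  (forall i, involves w i -> restricted_values w (upd S i (B i)) `<=` N) ->
  (forall i, S i (x i)) -> (forall i, S i (x' i)) ->
  (forall i, involves w i -> x' i = x i \/ B i (x' i / x i)) ->
  N (word_eval w x' / word_eval w x).
Proof.
move=> mw nN SJ BJ + Sx Sx'; elim: mw N nN => [i|u v mu IHu mv IHv uv] N nN.
  rewrite !eval_var => BN /(_ i); rewrite involves_var eqxx => -[] // xx'.
    by rewrite xx' mulgV; apply: nsub1 nN.
  apply: (BN i); first by rewrite involves_var.
  exists (upd x i (x' i / x i)); last by rewrite eval_var upd_same.
  by move=> j; rewrite /upd; case: eqP => [_|_].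
move=> BN xx'; rewrite !eval_comm.
have vu i : involves v i -> ~~ involves u i.
  by move=> vi; apply/negP => /uv; rewrite vi.
pose V (t : word n) : set G :=
  [set z | exists2 i, involves t i & restricted_values t (upd S i (B i)) z].
pose D t := ncl [set: G] (V t).
have uSJ i j a b : upd S i (B i) j a -> upd S i (B i) j (a ^ b).
  by rewrite /upd; case: eqP => [_|_]; [apply: (BJ i) | apply: (SJ j)].
have VJ t z k : V t z -> V t (z ^ k).
  by move=> [i ti Vz]; exists i => //; apply: restricted_valuesJ => //;
    apply: uSJ.
have Du : D u (word_eval u x' / word_eval u x).
  (* The induction hypotheses are used modulo [D u] and [D v] instead of [N]. *)
  apply: IHu => [|i ui z Vz|i ui]; first exact: ncl_normalized.
    by apply: sub_ncl; exists i.
  by apply: xx'; rewrite involves_comm ui.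
have Dv : D v (word_eval v x' / word_eval v x).
  apply: IHv => [|i vi z Vz|i vi]; first exact: ncl_normalized.
    by apply: sub_ncl; exists i.
  by apply: xx'; rewrite involves_comm vi orbT.
move: Du Dv.
set s := word_eval u x; set s' := word_eval u x'.
set t := word_eval v x; set t' := word_eval v x' => Du Dv.
(* Pass from [[~ s, t]] to [[~ s', t]], then to [[~ s', t']]. Each factor is a conjugate of a
   commutator of a change with a restricted value, as [comm_ncl_r] requires. *)
have -> : [~ s', t'] / [~ s, t] =
    [~ s', t' / t] ^ (t * [~ s', t]^-1) * [~ s' / s, t] ^ s by group_norm.
have Su : restricted_values u S s' by exists x'.
have Sv : restricted_values v S t by exists x.
have tupN i g h : (forall j, involves u j -> upd S i (B i) j (g j)) ->
    (forall j, ~~ involves u j -> upd S i (B i) j (h j)) ->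
    involves u i || involves v i -> N [~ word_eval u g, word_eval v h].
  move=> Sg Sh uvi; rewrite -eval_splice //; apply: (BN i).
    by rewrite involves_comm.
  exists (splice u g h) => // j; rewrite /splice.
  case: ifP => [/Sg //|/negbT uj].
  exact: Sh.
apply: (nsubM nN); apply: normalJ => //.
  apply: (@comm_ncl_r _ setT (restricted_values u S) (V v)) => //.
  - by move=> a b ? _; apply: restricted_valuesJ.
  - move=> _ _ [g Sg <-] [i vi [h Sh <-]]; apply: (tupN i) => // [j uj|].
      by rewrite /upd; case: eqP => // ji; move: (vu i vi); rewrite -ji uj.
    by rewrite vi orbT.
rewrite -invgR; apply: (nsubV nN).
apply: (@comm_ncl_r _ setT (restricted_values v S) (V u)) => //.
- by move=> a b ? _; apply: restricted_valuesJ.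
- move=> _ _ [h Sh <-] [i ui [g Sg <-]]; rewrite -invgR; apply: (nsubV nN).
  apply: (tupN i) => // [j uj|]; last by rewrite ui.
  by rewrite /upd; case: eqP => // ji; move: uj; rewrite ji ui.
Qed.

Definition commutators (X Y : set G) : set G :=
  [set [~ x, y] | x in X & y in Y].

Lemma commutatorsJ X Y z k : normal X -> normal Y ->
  commutators X Y z -> commutators X Y (z ^ k).
Proof.
move=> nX nY [x Xx [y Yy <-]]; rewrite conjRg.
by exists (x ^ k); [apply: normalJ | exists (y ^ k) => //; apply: normalJ].
Qed.

Fixpoint derived k : set G :=
  if k is k'.+1 then ncl setT (commutators (derived k') (derived k')) else setT.

Lemma derived_normal k : normal (derived k).
Proof. by case: k => [|k]; [apply: normalT | apply: ncl_normalized]. Qed.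

Lemma derived_comm k (x y : G) :
  derived k x -> derived k y -> derived k.+1 [~ x, y].
Proof. by move=> dx dy; apply: sub_ncl; exists x => //; exists y. Qed.

Lemma derivedS k : derived k.+1 `<=` derived k.
Proof.
move=> x; apply; first exact: derived_normal.
move=> _ [y dy [z dz <-]]; apply: normal_comm_sub => //; exact: derived_normal.
Qed.

Lemma derived_decr k l : (k <= l)%N -> derived l `<=` derived k.
Proof.
move=> /subnK <-; elim: (l - k)%N => [|m IH] //.
by apply: subset_trans IH; apply: derivedS.
Qed.

(** If [derived a] and [derived b] lie in the subgroups generated by the values of [u] and [v], then
    by [comm_ncl] the commutators of elements of [derived (maxn a b)] lie in the one generated by
    the values of [[u, v]]. *)
Lemma derived_sub_verbal w : multilinear_commutator w ->
  exists d, derived d `<=` ncl setT (word_values G w).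
Proof.
elim=> [i|u v mu [a da] mv [b db] uv].
  exists 0%N => x _; apply: sub_ncl; exists (fun _ => x) => //.
  by rewrite eval_var.
exists (maxn a b).+1 => x; apply; first exact: ncl_normalized.
move=> _ [y dy [z dz <-]].
have uJ (t : word n) c k : word_values G t c -> word_values G t (c ^ k).
  by move=> [g _ <-]; exists (fun i => g i ^ k) => //; apply: eval_conj.
apply: (@comm_ncl _ setT (word_values G u) (word_values G v)) => //.
- by move=> ? ? ? _; apply: uJ.
- exact: ncl_normalized.
- move=> _ _ [g _ <-] [h _ <-]; apply: sub_ncl.
  by exists (splice u g h) => //; apply: eval_splice.
- by apply: da; apply: derived_decr dy; apply: leq_maxl.
- by apply: db; apply: derived_decr dz; apply: leq_maxr.
Qed.

End RestrictedValues.

(** * Variation of a word on a product of cosets *)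

Section Variation.
Variables (n : nat) (G : groupType) (H K : set G).
Hypotheses (nH : normal H) (nK : normal K).
Implicit Types (u v w : word n) (a b x : 'I_n -> G).

Definition box a : set ('I_n -> G) := [set b | forall i, K (b i / a i)].

(** It is trivial exactly when [u] is constant on the box. Constancy of a commutator is not
    inherited by its two entries, so inductions on words keep track of this set instead. *)
Definition variation u a : set G :=
  [set word_eval u b / word_eval u c | b in box a & c in box a].

Lemma box_refl a : box a a.
Proof. by move=> i; rewrite mulgV; apply: nsub1 nK. Qed.

Lemma boxJ a b k : K k -> box a b -> box a (fun i => b i ^ k).
Proof.
move=> Kk ab i; have -> : b i ^ k / a i = k^-1 * k ^ (b i)^-1 * (b i / a i).
  by group_norm.
by apply: (nsubM nK) => //; apply: (nsubM nK);
  [apply: (nsubV nK) | apply: normalJ].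
Qed.

Lemma variationJ u a z k : variation u a z -> K k -> variation u a (z ^ k).
Proof.
move=> [b ab [c ac <-]] Kk; rewrite conjMg conjVg -!eval_conj.
exists (fun i => b i ^ k); first exact: boxJ.
by exists (fun i => c i ^ k) => //; apply: boxJ.
Qed.

Lemma box_eval u a b : box a b -> K (word_eval u b / word_eval u a).
Proof. by move=> ab; apply: eval_congr. Qed.

Lemma variation_sub u a : variation u a `<=` K.
Proof.
move=> _ [b ab [c ac <-]]; apply: eval_congr => // i.
have -> : b i / c i = (b i / a i) * (c i / a i)^-1 by group_norm.
by apply: (nsubM nK) => //; apply: (nsubV nK).
Qed.

(** Used to replace conjugators formed from values at arbitrary points of the box by those at the
    base point [a], to which they are congruent modulo [K]. *)
Lemma conj_shift Q (x m m' : G) : normalized_subgroup K Q -> K (m' / m) ->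
  Q (x ^ m') -> Q (x ^ m).
Proof.
move=> nQ Kmm Qx; have -> : x ^ m = (x ^ m') ^ (((m' / m)^-1) ^ m').
  by group_norm.
by apply: (nsubJ nQ) => //; apply: normalJ => //; apply: (nsubV nK).
Qed.

Lemma box_splice u a b c : box a b -> box a c -> box a (splice u b c).
Proof. by move=> ab ac i; rewrite /splice; case: ifP. Qed.

Lemma mixed_variation u v a b c b' c' :
  (forall i, involves u i -> ~~ involves v i) ->
  box a b -> box a c -> box a b' -> box a c' ->
  variation (word_comm u v) a
    ([~ word_eval u b, word_eval v c] / [~ word_eval u b', word_eval v c']).
Proof.
move=> uv ab ac ab' ac'; exists (splice u b c); first exact: box_splice.
exists (splice u b' c'); first exact: box_splice.
by rewrite !eval_splice.
Qed.

Section Commutator.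
Variables (u v : word n) (a : 'I_n -> G).
Hypothesis uv : forall i, involves u i -> ~~ involves v i.
Let C := ncl K (variation (word_comm u v) a).
Let nC : normalized_subgroup K C := ncl_normalized K _.
Let s0 := word_eval u a.
Let t0 := word_eval v a.
Let values w := [set word_eval w b | b in box a].

Let valuesJ w z k : values w z -> K k -> values w (z ^ k).
Proof.
move=> [b ab <-] Kk; exists (fun i => b i ^ k); last exact: eval_conj.
exact: boxJ.
Qed.

(** For values [t], [t'] of [v] and [s], [s'] of [u], the conjugate of [[~ t / t', s / s']] by
    [t' * s'] expands into two quotients of values of [[u, v]] on the box, the second one inverted.
    The next two lemmas keep one entry at its base value. *)
Lemma variation_comm y z :
  ncl K (variation v a) y -> ncl K (variation u a) z ->
  C ([~ z, y] ^ (t0 * s0)).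
Proof.
move=> Vy Vz; rewrite -invgR conjVg; apply: (nsubV nC).
pose Q : set G := fun x : G => C (x ^ (t0 * s0)); change (Q [~ y, z]).
apply: (@comm_ncl _ K (variation v a) (variation u a) Q) => //.
- exact: variation_sub.
- exact: variation_sub.
- by move=> x k Vx Kk; apply: variationJ.
- exact: conj_normalized.
move=> _ _ [c ac [c' ac' <-]] [b ab [b' ab' <-]].
apply: (@conj_shift C _ _ (word_eval v c' * word_eval u b')) => //.
  have -> : word_eval v c' * word_eval u b' / (t0 * s0) =
      (word_eval u b' / s0) ^ (word_eval v c')^-1 * (word_eval v c' / t0).
    by group_norm.
  by apply: (nsubM nK); [apply: normalJ => //|]; apply: box_eval.
have -> : [~ word_eval v c / word_eval v c', word_eval u b / word_eval u b']
    ^ (word_eval v c' * word_eval u b') =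
  ([~ word_eval u b', word_eval v c] / [~ word_eval u b, word_eval v c]) *
  ([~ word_eval u b', word_eval v c'] / [~ word_eval u b, word_eval v c'])^-1.
  by group_norm.
apply: (nsubM nC); last apply: (nsubV nC);
  by apply: sub_ncl; apply: mixed_variation.
Qed.

Lemma variation_comm_r y : ncl K (variation v a) y -> C ([~ s0, y] ^ (t0 ^ s0)).
Proof.
move=> Vy; pose Q : set G := fun x : G => C (x ^ (t0 ^ s0)).
change (Q [~ s0, y]).
apply: (@comm_ncl_r _ K (values u) (variation v a) Q) => //.
- exact: variation_sub.
- by move=> x k; apply: valuesJ.
- exact: conj_normalized.
- move=> _ _ [b ab <-] [c ac [c' ac' <-]].
  set s := word_eval u b; set t := word_eval v c; set t' := word_eval v c'.
  have Ks : K (s / s0) by apply: box_eval.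
  apply: (@conj_shift C _ _ (t' ^ s)) => //.
    have -> : t' ^ s / t0 ^ s0 = ((s / s0)^-1) ^ s *
        ((s / s0) ^ t'^-1 * (t' / t0)) ^ s0 by group_norm.
    apply: (nsubM nK); apply: normalJ => //; first exact: (nsubV nK).
    by apply: (nsubM nK); [apply: normalJ | apply: box_eval].
  have -> : [~ s, t / t'] ^ (t' ^ s) = [~ s, t] / [~ s, t'] by group_norm.
  by apply: sub_ncl; apply: mixed_variation.
- by exists a => //; apply: box_refl.
Qed.

Lemma variation_comm_l z : ncl K (variation u a) z -> C ([~ z, t0] ^ s0).
Proof.
move=> Vz; rewrite -invgR conjVg; apply: (nsubV nC).
pose Q : set G := fun x : G => C (x ^ s0); change (Q [~ t0, z]).
apply: (@comm_ncl_r _ K (values v) (variation u a) Q) => //.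
- exact: variation_sub.
- by move=> x k; apply: valuesJ.
- exact: conj_normalized.
- move=> _ _ [c ac <-] [b ab [b' ab' <-]].
  set t := word_eval v c; set s := word_eval u b; set s' := word_eval u b'.
  apply: (@conj_shift C _ _ s') => //; first exact: box_eval.
  have -> : [~ t, s / s'] ^ s' = [~ s', t] / [~ s, t] by group_norm.
  by apply: sub_ncl; apply: mixed_variation.
- by exists a => //; apply: box_refl.
Qed.

End Commutator.

(* Passing from [u] and [v] to [[u, v]] costs a conjugation by a product of
   values of those of [u], [v] that involve a letter of [I]: it lies in [H]. *)
Lemma eval_in_variation (I : pred 'I_n) w a : multilinear_commutator w ->
  (exists2 i, I i & involves w i) -> (forall i, I i -> H (a i)) ->
  exists2 a' : 'I_n -> G, forall i, exists2 h, H h & a' i = a i ^ h &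
    forall x, (forall i, involves w i -> I i -> K (x i)) ->
      (forall i, involves w i -> ~~ I i -> x i = a' i) ->
      ncl K (variation w a) (word_eval w x).
Proof.
move=> mw + Ha; elim: mw => [i|u v mu IHu mv IHv uv] wI.
  exists a => [j|x Kx _]; first by exists 1; [apply: nsub1 nH | rewrite conjg1].
  (* The element [x i] is the quotient of [x i * a i] by [a i], two values of the variable on the
     box. *)
  apply: sub_ncl; exists (upd a i (x i * a i)) => [j|].
    rewrite /upd; case: eqP => [->|_]; last exact: box_refl.
    rewrite mulgK; case: wI => k Ik; rewrite involves_var => /eqP ki.
    by rewrite -ki; apply: Kx; rewrite ?involves_var // ki.
  exists a; first exact: box_refl.
  by rewrite !eval_var upd_same mulgK.
have Hval (t : word n) : multilinear_commutator t ->
    (exists2 i, I i & involves t i) -> H (word_eval t a).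
  by move=> mt [i Ii ti]; apply: (eval_in_normal mt nH ti); apply: Ha.
have inI (t : word n) : ~ (exists2 i, I i & involves t i) ->
    forall i, involves t i -> ~~ I i.
  by move=> nt i ti; apply/negP => Ii; apply: nt; exists i.
have conjK m (f x : 'I_n -> G) (t : word n) :
    (forall i, involves t i -> ~~ I i -> x i = f i ^ m) ->
    forall i, involves t i -> ~~ I i -> x i ^ m^-1 = f i.
  by move=> xf i ti Ii; rewrite xf // conjgK.
have conjE m (x : 'I_n -> G) (t : word n) :
    word_eval t x = word_eval t (fun i => x i ^ m^-1) ^ m.
  by rewrite -eval_conj; apply: eq_eval => i _; rewrite conjgKV.
have splice_conj m f g :
    H m -> (forall i, exists2 h, H h & f i = a i ^ h) ->
    (forall i, exists2 h, H h & g i = a i ^ h) ->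
    forall i, exists2 h, H h & splice u f g i ^ m = a i ^ h.
  move=> Hm fa ga i; rewrite /splice; case: ifP => _;
    [case: (fa i) | case: (ga i)] => h Hh ->;
    by exists (h * m); [apply: (nsubM nH) | rewrite conjgM].
have refl_conj i : exists2 h, H h & a i = a i ^ h.
  by exists 1; [apply: nsub1 nH | rewrite conjg1].
have [uI|/inI uI] := pselect (exists2 i, I i & involves u i);
  have [vI|/inI vI] := pselect (exists2 i, I i & involves v i).
- case: (IHu uI) => au aua Cu; case: (IHv vI) => av ava Cv.
  (* [variation_comm] conjugates by [m]: the new tuple is the [m]-conjugate of the spliced one, and
     [x] is conjugated back before the induction hypotheses apply. *)
  pose m := word_eval v a * word_eval u a.
  have Hm : H m by apply: (nsubM nH); apply: Hval.
  exists (fun i => splice u au av i ^ m); first exact: splice_conj.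
  move=> x Kx xa; rewrite (conjE m x) eval_comm.
  apply: variation_comm => //.
    apply: Cv => [i vi Ii|].
      by apply: normalJ => //; apply: Kx => //; rewrite involves_comm vi orbT.
    apply: conjK => i vi Ii; rewrite xa ?involves_comm ?vi ?orbT // /splice.
    by case: ifP => // /uv; rewrite vi.
  apply: Cu => [i ui Ii|].
    by apply: normalJ => //; apply: Kx => //; rewrite involves_comm ui.
  by apply: conjK => i ui Ii; rewrite xa ?involves_comm ?ui // /splice ui.
- case: (IHu uI) => au aua Cu.
  pose m := word_eval u a.
  have Hm : H m by apply: Hval.
  exists (fun i => splice u au a i ^ m); first exact: splice_conj.
  move=> x Kx xa; rewrite (conjE m x) eval_comm.
  (* No letter of [v] is in [I], so on [v] conjugating back turns [x] into [a]. *)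
  have -> : word_eval v (fun i => x i ^ m^-1) = word_eval v a.
    apply: eq_eval => i vi; rewrite xa ?vI ?involves_comm ?vi ?orbT //.
    by rewrite conjgK /splice; case: ifP => // /uv; rewrite vi.
  apply: variation_comm_l => //.
  apply: Cu => [i ui Ii|].
    by apply: normalJ => //; apply: Kx => //; rewrite involves_comm ui.
  by apply: conjK => i ui Ii; rewrite xa ?involves_comm ?ui // /splice ui.
- case: (IHv vI) => av ava Cv.
  pose m := word_eval v a ^ word_eval u a.
  have Hm : H m by apply: normalJ => //; apply: Hval.
  exists (fun i => splice u a av i ^ m); first exact: splice_conj.
  move=> x Kx xa; rewrite (conjE m x) eval_comm.
  have -> : word_eval u (fun i => x i ^ m^-1) = word_eval u a.
    apply: eq_eval => i ui; rewrite xa ?uI ?involves_comm ?ui //.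
    by rewrite conjgK /splice ui.
  apply: variation_comm_r => //.
  apply: Cv => [i vi Ii|].
    by apply: normalJ => //; apply: Kx => //; rewrite involves_comm vi orbT.
  apply: conjK => i vi Ii; rewrite xa ?involves_comm ?vi ?orbT // /splice.
  by case: ifP => // /uv; rewrite vi.
- exfalso; case: wI => i Ii; rewrite involves_comm => /orP[/uI|/vI];
  by rewrite Ii.
Qed.

End Variation.

(** * Pigeonhole and coding for finite sets *)

Lemma finite_repetition T (A : set T) (f : nat -> T) :
  finite_set A -> (forall k, A (f k)) -> exists i j, (i < j)%N /\ f i = f j.
Proof.
move=> finA Af; apply: contrapT => nrep.
suff : finite_set [set: nat] by exact: infinite_nat.
have <- : f @^-1` A = setT by apply/seteqP; split=> // k _; apply: Af.
apply: finite_preimage => // i j _ _ fij.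
case: (ltngtP i j) => // ij; exfalso; apply: nrep.
  by exists i, j.
by exists j, i.
Qed.

Lemma finite_of_codes C T (A : set C) (X : set T) (R : C -> T -> Prop) :
  finite_set A -> (forall x, X x -> exists2 c, A c & R c x) ->
  (forall c x y, R c x -> R c y -> x = y) -> finite_set X.
Proof.
move=> finA XR Rfun.
(* [x0] is the default for codes that stand for no element. *)
have [->|/set0P[x0 _]] := eqVneq X set0; first exact: finite_set0.
have /choice[f fR] c : exists y, forall x, R c x -> y = x.
  have [[x Rx]|nR] := pselect (exists x, R c x).
    by exists x => y Ry; apply: Rfun Rx Ry.
  by exists x0 => x Rx; exfalso; apply: nR; exists x.
apply: sub_finite_set (finite_image f finA) => x /XR[c Ac /fR fc].
by exists c.
Qed.

(** * Finite normal subgroups: Dietzmann's lemma and Schur's theorem *)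

Section FiniteNormal.
Variable G : groupType.
Implicit Types (x y z : G) (N X H W : set G) (l : seq G).

(** Normality allows one to compute modulo [N], and to join two such subgroups by taking their
    product. *)
Definition in_finite_normal X :=
  exists N, [/\ normal N, finite_set N & X `<=` N].

Lemma in_finite_normalU X Y :
  in_finite_normal X -> in_finite_normal Y -> in_finite_normal (X `|` Y).
Proof.
move=> [M [nM finM XM]] [N [nN finN YN]].
exists [set x * y | x in M & y in N]; split; last first.
- move=> x [/XM Mx|/YN Nx].
    by exists x => //; exists 1; [apply: nsub1 nN | rewrite mulg1].
  by exists 1; [apply: nsub1 nM | exists x; rewrite ?mul1g].
- exact: finite_image2.
split=> [|_ _ [x Mx [y Ny <-]] [x' Mx' [y' Ny' <-]]|_ [x Mx [y Ny <-]]
    |_ k [x Mx [y Ny <-]] _].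
- exists 1; [exact: nsub1 nM | exists 1; [exact: nsub1 nN | exact: mulg1]].
- exists (x * x' ^ y^-1); first by apply: (nsubM nM) => //; apply: normalJ.
  by exists (y * y'); [apply: (nsubM nN) | group_norm].
- exists (x^-1 ^ y); first by apply: normalJ => //; apply: (nsubV nM).
  by exists (y^-1); [apply: (nsubV nN) | group_norm].
- exists (x ^ k); first exact: normalJ.
  by exists (y ^ k); [apply: normalJ | rewrite conjMg].
Qed.

Lemma in_finite_normal0 : in_finite_normal set0.
Proof.
by exists [set 1]; split=> //; apply: normal1.
Qed.

Lemma in_finite_normal_bigU (I : finType) (X : I -> set G) :
  (forall i, in_finite_normal (X i)) -> in_finite_normal (\bigcup_i X i).
Proof.
move=> fX.
suff [N [nN finN XN]] :
    in_finite_normal [set z | exists2 i, i \in enum I & X i z].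
  exists N; split=> // z [i _ Xz]; apply: XN.
  by exists i => //; rewrite mem_enum.
elim: (enum I) => [|i s IH].
  by have [N [? ? _]] := in_finite_normal0; exists N; split=> // z [].
have [N [nN finN XN]] := in_finite_normalU (fX i) IH.
exists N; split=> // z [j]; rewrite inE => /orP[/eqP -> Xz|js Xz]; apply: XN.
  by left.
by right; exists j.
Qed.

(** The number of factors matters: [dietzmann] does not ask that [x ^+ M] be 1, only that it be a
    product of fewer than [M] elements of [X]. *)
Definition products X m :=
  [set z | exists l,
    [/\ (forall y, y \in l -> X y), size l = m & z = \prod_(x <- l) x]].

(** Since [y * x ^+ k = x ^+ k * y ^ (x ^+ k)], the copies of [x] move to the front and the factors
    they pass become conjugates, still in [X]. *)
Lemma extract_power X x k l : (forall x y, X x -> X (x ^ y)) ->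
  (forall y, y \in l -> X y) -> (k <= count_mem x l)%N ->
  exists l', [/\ (forall y, y \in l' -> X y), (size l' + k = size l)%N &
    \prod_(y <- l) y = x ^+ k * \prod_(y <- l') y].
Proof.
move=> XJ; elim: l k => [|y l IH] k lX.
  by rewrite leqn0 => /eqP ->; exists [::]; rewrite big_nil mulg1.
have [Xy lX'] : X y /\ (forall y, y \in l -> X y).
  split=> [|z zl]; last by apply: lX; rewrite inE zl orbT.
  by apply: lX; rewrite inE eqxx.
case: k => [_|k /=]; first by exists (y :: l); rewrite addn0 mul1g.
case: eqP => [->|_]; rewrite ?add1n ?add0n big_cons => kl.
  have [l' [l'X szl' ->]] := IH k lX' kl; exists l'.
  by rewrite addnS szl' expgS mulgA.
have [l' [l'X szl' ->]] := IH k.+1 lX' kl; exists (y ^ (x ^+ k.+1) :: l').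
split=> [z||]; last by rewrite big_cons [LHS]mulgA [RHS]mulgA (conjgC y).
  by rewrite inE => /orP[/eqP ->|/l'X //]; apply: XJ.
by rewrite /= addSn szl'.
Qed.

Lemma size_sum_count l s : {subset l <= s} -> forall M,
  (forall x, x \in s -> count_mem x l <= M)%N -> (size l <= size s * M)%N.
Proof.
move=> ls M; elim: s l ls => [|x s IH] l ls cl /=.
  by case: l ls {cl} => // y l /(_ y); rewrite inE eqxx => /(_ isT).
rewrite -(count_predC (pred1 x) l) mulSn leq_add ?cl ?inE ?eqxx //.
rewrite -size_filter; apply: IH => [y|y ys].
  by rewrite mem_filter /= => /andP[yx /ls]; rewrite inE (negPf yx).
apply: leq_trans (cl y _); last by rewrite inE ys orbT.
by rewrite count_filter; apply: sub_count => z /= /andP[].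
Qed.

(* Collecting equal factors at the front shortens every product of more than
   [#|X| * M] elements of [X]. *)
Lemma dietzmann X M : finite_set X -> (forall x y, X x -> X (x ^ y)) ->
  (forall x, X x -> exists2 m, (m < M)%N & products X m (x ^+ M)) ->
  in_finite_normal X.
Proof.
move=> /finite_seqP[s Xs] XJ XM.
have Xmem x : (x \in X) = (x \in s).
  by apply/idP/idP => [/set_mem|xs]; [|apply/mem_set]; rewrite Xs.
have short l : (forall y, y \in l -> X y) -> exists l',
    [/\ (forall y, y \in l' -> X y),
    (size l' <= size s * M)%N & \prod_(y <- l) y = \prod_(y <- l') y].
  elim: {l}_.+1 {-2}l (ltnSn (size l)) => // k IH l; rewrite ltnS => lk lX.
  have [le|gt] := leqP (size l) (size s * M); first by exists l.
  have [x xs xl] : exists2 x, x \in s & (M < count_mem x l)%N.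
    apply: contrapT => nx; move: gt; rewrite ltnNge => /negP; apply.
    apply: size_sum_count => [y /lX Xy|x xs];
      first by rewrite -Xmem; apply: mem_set.
    by rewrite leqNgt; apply/negP => Mx; apply: nx; exists x.
  have [l' [l'X szl' ->]] := extract_power XJ lX (ltnW xl).
  have Xx : X x by apply: set_mem; rewrite Xmem.
  have [m mM [l0 [l0X szl0 ->]]] := XM x Xx.
  rewrite -big_cat; apply: IH; last first.
    by move=> y; rewrite mem_cat => /orP[/l0X|/l'X].
  apply: leq_trans lk; rewrite size_cat szl0 -szl' addnC ltn_add2l //.
pose P : set G := \bigcup_m products X m.
have Pfin : finite_set P.
  have fin m : finite_set [set z | exists2 k, (k <= m)%N & products X k z].
    elim: m => [|m IH].
      apply: sub_finite_set (finite_set1 1) => z [k]; rewrite leqn0 => /eqP ->.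
      by move=> [l [_ /size0nil -> ->]]; rewrite big_nil.
    have finX : finite_set X by apply/finite_seqP; exists s.
    have finXm := finite_image2 (fun x y => x * y) finX IH.
    have fin1Xm := conj (finite_set1 (1 : G)) finXm.
    rewrite -finite_setU in fin1Xm; apply: sub_finite_set fin1Xm => z [].
    move=> [|k] km [[|x l] [lX szl ->]] //; first by left; rewrite big_nil.
    right; exists x; first by apply: lX; rewrite inE eqxx.
    exists (\prod_(y <- l) y); last by rewrite big_cons.
    exists k => //; exists l; split=> //; last by case: szl.
    by move=> y yl; apply: lX; rewrite inE yl orbT.
  apply: sub_finite_set (fin (size s * M)%N) => z [_ _ [l [lX _ ->]]].
  have [l' [l'X szl' ->]] := short l lX.
  by exists (size l') => //; exists l'.
have PM x y : P x -> P y -> P (x * y).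
  move=> [_ _ [l [lX _ ->]]] [_ _ [l' [l'X _ ->]]].
  exists (size (l ++ l')) => //; exists (l ++ l'); rewrite big_cat; split=> //.
  by move=> z; rewrite mem_cat => /orP[/lX|/l'X].
have P1 : P 1 by exists 0%N => //; exists [::]; rewrite big_nil.
have PX x k : P x -> P (x ^+ k).
  by move=> Px; elim: k => [|k IH] //; rewrite expgS; apply: PM.
exists P; split=> //; last first.
  move=> x Xx; exists 1%N => //; exists [:: x]; rewrite big_seq1; split=> //.
  by move=> y; rewrite inE => /eqP ->.
split=> // [x Px|x k [m _ [l [lX szl ->]]] _].
  (* [P] is a finite monoid, so the powers of [x] repeat and [x^-1] is one of them. *)
  have [i [j [ij xij]]] := finite_repetition Pfin (fun k => PX x k Px).
  have -> : x^-1 = x ^+ (j - i).-1; last exact: PX.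
  have ji : (0 < j - i)%N by rewrite subn_gt0.
  apply: (mulgI x); rewrite mulgV -expgS prednK //.
  by apply: (mulgI (x ^+ i)); rewrite mulg1 -expgnDr subnKC // ltnW.
exists m => //; exists [seq y ^ k | y <- l].
rewrite size_map szl conjg_prod big_map; split=> // y /mapP[z /lX Xz ->].
exact: XJ.
Qed.

Definition finite_index H :=
  exists s : seq G, forall x, exists2 a, a \in s & H (x / a).

Lemma finite_index_exponent H : normal H -> finite_index H ->
  exists2 m, (0 < m)%N & forall x, H (x ^+ m).
Proof.
move=> nH [s sH].
have tor x : exists2 m, (0 < m)%N & H (x ^+ m).
  have /choice[f fs] k : exists a, a \in s /\ H (x ^+ k / a).
    by have [a] := sH (x ^+ k); exists a.
  have [i [j [ij fij]]] : exists i j, (i < j)%N /\ f i = f j.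
    apply: (@finite_repetition _ [set` s]); first exact: finite_seq.
    by move=> k; case: (fs k).
  exists (j - i)%N; first by rewrite subn_gt0.
  have -> : x ^+ (j - i) = (x ^+ j / f j) / (x ^+ i / f i).
    by rewrite expgnFr ?(ltnW ij) // fij mulgKA.
  by apply: (nsubM nH); [case: (fs j) | apply: (nsubV nH); case: (fs i)].
(* A common exponent for the representatives is the product of theirs; it serves all [x] because
   congruence modulo [H] is preserved by powers. *)
have [m m0 sm] : exists2 m, (0 < m)%N & forall a, a \in s -> H (a ^+ m).
  elim: (s) => [|a s' [m m0 sm]]; first by exists 1%N.
  have [k k0 Hk] := tor a; exists (k * m)%N; first by rewrite muln_gt0 k0.
  move=> b; rewrite inE => /orP[/eqP ->|/sm Hb].
    by rewrite expgnA; apply: (nsubX _ nH).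
  by rewrite mulnC expgnA; apply: (nsubX _ nH).
exists m => // x; have [a /sm Ha Hxa] := sH x.
suff Hm k : H (x ^+ k / a ^+ k).
  by rewrite -[x ^+ m](mulgVK (a ^+ m)); apply: (nsubM nH).
elim: k => [|k IH]; first by rewrite mulgV; apply: nsub1 nH.
have -> : x ^+ k.+1 / a ^+ k.+1 = (x ^+ k / a ^+ k) ^ x^-1 * (x / a).
  by rewrite !expgS; group_norm.
by apply: (nsubM nH) => //; apply: normalJ.
Qed.

(** As [H] centralises [W], a commutator in [W] depends only on the cosets of its entries modulo
    [H], so there are finitely many. For [c = [~ a, b]] and [m] an exponent of [G/H], the element
    [c ^+ m] of [H] commutes with [b]. Hence [c ^+ m.+1 = [~ a, b ^+ 2] * (c ^ b) ^+ m.-1] is a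
    product of [m] commutators, and [dietzmann] applies. *)
Lemma schur H W : normal H -> finite_index H -> normal W ->
  (forall h w, H h -> W w -> commute h w) -> in_finite_normal (commutators W W).
Proof.
move=> nH fH nW HW.
have [m m0 Hm] := finite_index_exponent nH fH.
have [s sH] := fH.
apply: (@dietzmann _ m.+1).
- apply: (@finite_of_codes _ _ [set p : G * G | p.1 \in s /\ p.2 \in s] _
    (fun p z => exists a b, [/\ W a, W b, H (a / p.1), H (b / p.2) &
      z = [~ a, b]])).
  + apply: (@sub_finite_set _ _ ([set` s] `*` [set` s])) => //.
    by apply: finite_setX; apply: finite_seq.
  + move=> _ [a Wa [b Wb <-]]; have [c cs Hc] := sH a; have [d ds Hd] := sH b.
    by exists (c, d) => //; exists a, b.
  move=> [c d] _ _ [a [b [Wa Wb /= Ha Hb ->]]]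
    [a' [b' [Wa' Wb' /= Ha' Hb' ->]]].
  have quot x y z : W x -> W y -> H (x / z) -> H (y / z) ->
      exists h, [/\ H h, W h & x = h * y].
    move=> Wx Wy Hx Hy; exists (x / y); split; last by rewrite mulgVK.
      rewrite -(divgKA z); apply: (nsubM nH) => //.
      by rewrite -invgF; apply: (nsubV nH).
    by apply: (nsubM nW) => //; apply: (nsubV nW).
  have [h [Hh Wh ->]] := quot a a' c Wa Wa' Ha Ha'.
  have [k [Hk Wk ->]] := quot b b' d Wb Wb' Hb Hb'.
  have comm1 x y : H x -> W y -> [~ x, y] = 1.
    by move=> Hx Wy; apply/eqP/commgP/HW.
  have -> : [~ h * a', k * b'] = [~ h, k * b'] ^ a' *
      ([~ a', b'] * ([~ k, a']^-1) ^ b') by group_norm.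
  rewrite (comm1 k a') // (comm1 h) //; last exact: (nsubM nW).
  by rewrite invg1 !conj1g mul1g mulg1.
- by move=> x y; apply: commutatorsJ.
move=> c [a Wa [b Wb abc]]; exists m => //.
exists ([~ a, b ^+ 2] :: nseq m.-1 (c ^ b)); split.
- move=> z; rewrite inE mem_nseq => /orP[/eqP ->|/andP[_ /eqP ->]].
    by exists a => //; exists (b ^+ 2) => //; apply: (nsubX _ nW).
  by apply: commutatorsJ => //; exists a => //; exists b.
- by rewrite /= size_nseq prednK.
rewrite big_cons big_nseq iter_mulg_1.
have -> : [~ a, b ^+ 2] = c * c ^ b by rewrite -abc expg2; group_norm.
rewrite -mulgA -expgS prednK // expgS; congr (_ * _).
rewrite -conjXg conjgE (HW (c ^+ m)) ?mulKg //.
Qed.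

End FiniteNormal.

(** * Words that are trivial as soon as one letter lies in a subgroup of finite index *)

Section MarginalSubgroup.
Variables (n : nat) (G : groupType).
Implicit Types (u v w : word n) (x : 'I_n -> G) (A N X : set G).

Lemma in_finite_normal_sub X X' :
  X `<=` X' -> in_finite_normal X' -> in_finite_normal X.
Proof.
by move=> XX' [N [nN finN X'N]]; exists N; split=> //; apply: subset_trans X'N.
Qed.

(** The identity [[~ y * p, q] = [~ y, q] ^ p * [~ p, q]] splits off one factor at a time, and the
    conjugator [p] stays in [A]. *)
Lemma comm_products A X X' q m z : normal A -> X `<=` A ->
  (forall (y a : G), X y -> A a -> X' ([~ y, q] ^ a)) ->
  products X m z -> products X' m [~ z, q].
Proof.
move=> nA XA XX' [l [lX <- ->]] {m z}; elim: l lX => [|y l IH] lX.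
  by exists [::]; rewrite !big_nil comm1g.
have Xy : X y by apply: lX; rewrite inE eqxx.
have lX' z : z \in l -> X z by move=> zl; apply: lX; rewrite inE zl orbT.
have [l' [l'X' szl' el']] := IH lX'.
pose p := \prod_(z <- l) z.
have Ap : A p.
  by rewrite /p big_seq; apply: big_rec => [|z t /lX' /XA Az At];
    [apply: nsub1 nA | apply: (nsubM nA)].
exists ([~ y, q] ^ p :: l'); split=> [z||].
- by rewrite inE => /orP[/eqP ->|/l'X' //]; apply: XX'.
- by rewrite /= szl'.
- by rewrite !big_cons -el' -/p; group_norm.
Qed.

Lemma inv_products X m z :
  products X m z -> products [set y | X y^-1] m z^-1.
Proof.
move=> [l [lX <- ->]]; exists (rev [seq y^-1 | y <- l]); split.
- by move=> y; rewrite mem_rev => /mapP[t /lX Xt ->] /=; rewrite invgK.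
- by rewrite size_rev size_map.
- rewrite -map_rev big_map prodgV revK //.
Qed.

Lemma eq_products X X' m z : X `<=` X' -> products X m z -> products X' m z.
Proof. by move=> XX' [l [lX szl ->]]; exists l; split=> // y /lX /XX'. Qed.

Definition conjugates A x : set ('I_n -> G) :=
  [set y | forall i, exists2 a, A a & y i = x i ^ a].

Lemma conjugates_refl A x : normal A -> conjugates A x x.
Proof. by move=> nA i; exists 1; [apply: nsub1 nA | rewrite conjg1]. Qed.

Lemma conjugatesJ A x y (a : G) : normal A -> A a -> conjugates A x y ->
  conjugates A x (fun i => y i ^ a).
Proof.
move=> nA Aa xy i; have [b Ab ->] := xy i.
by exists (b * a); [apply: (nsubM nA) | rewrite conjgM].
Qed.

Lemma conjugates_splice A u x y z : conjugates A x y -> conjugates A x z ->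
  conjugates A x (splice u y z).
Proof. by move=> xy xz i; rewrite /splice; case: ifP. Qed.

(** Expanding a commutator with a product in one entry conjugates only by values that involve the
    letter [i]. These lie in [A] with [x i], so the factors are values at tuples conjugate to [x]
    under [A]. *)
Lemma eval_power w A i x m : multilinear_commutator w -> normal A ->
  involves w i -> A (x i) ->
  products [set word_eval w y | y in conjugates A x] m
    (word_eval w (upd x i (x i ^+ m))).
Proof.
move=> mw nA + Axi.
have inA (t : word n) : multilinear_commutator t -> involves t i ->
    [set word_eval t y | y in conjugates A x] `<=` A.
  move=> mt ti _ [y xy <-]; apply: (eval_in_normal mt nA ti).
  by have [a Aa ->] := xy i; apply: normalJ.
elim: mw => [j|u v mu IHu mv IHv uv].
  rewrite involves_var => /eqP <-; rewrite eval_var upd_same.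
  exists (nseq m (x i)); split.
  - move=> y; rewrite mem_nseq => /andP[_ /eqP ->].
    by exists x; [apply: conjugates_refl | rewrite eval_var].
  - by rewrite size_nseq.
  - by rewrite big_nseq iter_mulg_1.
have conjC y z a : conjugates A x y -> conjugates A x z -> A a ->
  [set word_eval (word_comm u v) y | y in conjugates A x]
    ([~ word_eval u y, word_eval v z] ^ a).
  move=> xy xz Aa; exists (fun j => splice u y z j ^ a).
    by apply: conjugatesJ => //; apply: conjugates_splice.
  by rewrite eval_conj eval_splice.
have xx := conjugates_refl x nA.
rewrite involves_comm eval_comm.
case: (boolP (involves u i)) => [ui _|ui /= vi].
  rewrite (eval_upd _ _ (uv i ui)).
  apply: (comm_products nA (inA u mu ui)) (IHu ui).
  by move=> _ a [y xy <-] Aa; apply: conjC.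
rewrite (eval_upd _ _ ui) -invgR.
have /inv_products : products
    [set z | [set word_eval (word_comm u v) y | y in conjugates A x] z^-1] m
    [~ word_eval v (upd x i (x i ^+ m)), word_eval u x].
  apply: (comm_products nA (inA v mv vi)) (IHv vi).
  by move=> _ a [y xy <-] Aa /=; rewrite -conjVg invgR; apply: conjC.
by apply: eq_products => z /=; rewrite invgK.
Qed.

Lemma products_congr N X m (z y : G) :
  normal N -> (forall t, X t -> N (t / y)) ->
  products X m z -> N (z / y ^+ m).
Proof.
move=> nN XN [l [lX <- ->]]; elim: l lX => [|t l IH] lX.
  by rewrite big_nil mulgV; apply: nsub1 nN.
rewrite big_cons /= expgS; set p := \prod_(_ <- _) _.
have -> : t * p / (y * y ^+ size l) = (t / y) * (p / y ^+ size l) ^ y^-1.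
  by group_norm.
apply: (nsubM nN); first by apply: XN; apply: lX; rewrite inE eqxx.
by apply: normalJ => //; apply: IH => s sl; apply: lX; rewrite inE sl orbT.
Qed.

Lemma finite_restricted_values w H d :
  multilinear_commutator w -> normal H -> finite_index H ->
  (forall i x, involves w i -> H (x i) -> word_eval w x = 1) ->
  finite_set (word_values G w) -> in_finite_normal (@derived G d.+1) ->
  forall k : 'I_n -> nat,
  in_finite_normal (restricted_values w (fun i => @derived G (k i))).
Proof.
move=> mw nH fH wH finw [D [nD finD dD]] k.
have [m m0 Hm] := finite_index_exponent nH fH.
(* Raising some [k i <= d] lowers this sum; once some [k i > d] for a letter [i] of [w], the values
   lie in [D]. *)
have [r] := ubnP (\sum_i (d.+1 - k i))%N; elim: r k => // r IH k.
rewrite ltnS => kr.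
have [[i wi dki]|small] := pselect (exists2 i, involves w i & (d < k i)%N).
  exists D; split=> // _ [x kx <-]; apply: (eval_in_normal mw nD wi).
  by apply: dD; apply: derived_decr (kx i).
have {}small i : involves w i -> (k i <= d)%N.
  by move=> wi; rewrite leqNgt; apply/negP => dki; apply: small; exists i.
pose k' i := upd k i (k i).+1.
(* The condition on [i] is kept inside the set: the sum is only known to decrease for letters of
   [w]. *)
have fin_k' i : in_finite_normal [set z | involves w i /\
    restricted_values w (fun j => @derived G (k' i j)) z].
  case: (boolP (involves w i)) => [wi|wi]; last first.
    by have [N [nN finN _]] := in_finite_normal0 G; exists N; split=> // z [].
  have [|N [nN finN XN]] := IH (k' i).
    apply: leq_trans kr; rewrite (bigD1 i) //= [leqRHS](bigD1 i) //=.
    rewrite /k' upd_same -addSn.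
    apply: leq_add; first by rewrite subSS -subSn ?small.
    by apply: leq_sum => j ji; rewrite /upd (negPf ji).
  by exists N; split=> // z [_ /XN].
have [N [nN finN k'N]] := in_finite_normal_bigU fin_k'.
have [i0 wi0] := mlc_involves mw.
have [i wi imax] : exists2 i, involves w i &
    forall j, involves w j -> (k j <= k i)%N.
  by case: (arg_maxnP k wi0) => i wi imax; exists i => // j /imax.
pose A := @derived G (k i).
have nA : normal A by apply: derived_normal.
pose S j := @derived G (k j).
have SJ j a b : S j a -> S j (a ^ b).
  by apply: normalJ; apply: derived_normal.
(* With [N] added, a power lying in [N] counts as a single factor. The exponent [m + m] instead of
   [m] ensures that it exceeds 1. *)
apply: (@in_finite_normal_sub _ (restricted_values w S `|` N)).
  by move=> z Sz; left.
apply: (@dietzmann _ _ (m + m)%N).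
- rewrite finite_setU; split=> //; apply: sub_finite_set finw.
  by move=> _ [x _ <-]; exists x.
- by move=> x y [Sx|Nx];
    [left; apply: restricted_valuesJ | right; apply: normalJ].
move=> z Sz; exists 1%N; first by case: (m) m0 => // q _; rewrite addnS.
exists [:: z ^+ (m + m)]; rewrite big_seq1; split=> // _ /[1!inE] /eqP ->.
right; rewrite expgnDr; case: Sz => [|Nz]; last first.
  by apply: (nsubM nN); apply: (nsubX _ nN).
move=> [x Sx <-].
suff Nx : N (word_eval w x ^+ m) by apply: (nsubM nN).
rewrite -(nsubVE _ nN) -[_^-1]mul1g.
(* Here 1 is read as the value with [x i ^+ m] in place of [x i]. By [eval_power] it is a product of
   [m] values at conjugates of [x], each congruent to [word_eval w x] modulo [N]. *)
rewrite -(@wH i (upd x i (x i ^+ m))) ?upd_same //.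
apply: products_congr (eval_power m mw nA wi (Sx i)) => // _ [y xy <-].
apply: (@eval_shift _ _ w S (fun j => @derived G (k j).+1)) => //.
- by move=> j a b; apply: normalJ; apply: derived_normal.
- move=> j wj _ [t St <-]; apply: k'N; exists j => //; split=> //.
  exists t => // l; move: (St l); rewrite /upd /k' /upd.
  by case: eqP => [->|].
- by move=> j; have [a Aa ->] := xy j; apply: SJ.
move=> j wj; right; have [a Aa ->] := xy j.
(* The maximality of [k i] puts this commutator in [derived (k j).+1]: either [a] and [x j] lie in
   the same term, or [a] already lies in that smaller one. *)
have -> : x j ^ a / x j = [~ a, (x j)^-1] by group_norm.
have := imax j wj; rewrite leq_eqVlt => /orP[/eqP kji|kji].
  apply: derived_comm; first by rewrite kji.
  by apply: (nsubV (derived_normal G (k j))); apply: Sx.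
apply: (normal_comm_sub _ (derived_normal G (k j).+1)).
exact: (derived_decr kji Aa).
Qed.

Theorem marginal_finite_verbal w H :
  multilinear_commutator w -> normal H -> finite_index H ->
  (forall i x, involves w i -> H (x i) -> word_eval w x = 1) ->
  in_finite_normal (word_values G w).
Proof.
move=> mw nH fH wH; have [s sH] := fH.
have shift (x y : 'I_n -> G) :
    (forall i, H (x i / y i)) -> word_eval w x = word_eval w y.
  move=> xyH; apply: divg1_eq.
  apply: (@eval_shift _ _ w (fun=> setT) (fun=> H)) (normal1 G) _ _ _ _ _ _
    => //.
  - by move=> _ a b; apply: normalJ.
  - by move=> i wi _ [z Hz <-]; apply: (wH i) => //;
    have := Hz i; rewrite upd_same.
  - by move=> i _; right.
have finw : finite_set (word_values G w).
  apply: (@finite_of_codes {ffun 'I_n -> seq_sub s} _ setT _ (fun c z =>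
    exists2 x, forall i, H (x i / val (c i)) & z = word_eval w x)).
  - exact: finite_finset.
  - move=> _ [x _ <-].
    have /choice[c cH] i : exists a : seq_sub s, H (x i / val a).
      by have [a sa Ha] := sH (x i); exists (SeqSub sa).
    by exists (finfun c) => //; exists x => // i; rewrite ffunE.
  move=> c _ _ [x xc ->] [y yc ->]; apply: shift => i.
  rewrite -(divgKA (val (c i))); apply: (nsubM nH) => //.
  by rewrite -invgF; apply: (nsubV nH).
pose W := ncl setT (word_values G w).
have nW : normal W by apply: ncl_normalized.
(* Conjugating a value by [h] conjugates its letters, which does not change them modulo [H]; so [h]
   fixes the value. The centraliser of [H] is normal, hence contains [W]. *)
have HW (h x : G) : H h -> W x -> commute h x.
  move=> Hh Wx; apply/commgP/eqP.
  have nC : normal [set y | forall h, H h -> [~ h, y] = 1].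
    split=> [a _|a b Ca Cb c Hc|a Ca c Hc|a b Ca _ c Hc] /=.
    - exact: commg1.
    - have -> : [~ c, a * b] = [~ c, b] * [~ c, a] ^ b by group_norm.
      by rewrite Ca // Cb // conj1g mulg1.
    - have -> : [~ c, a^-1] = ([~ c, a] ^ a^-1)^-1 by group_norm.
      by rewrite Ca // conj1g invg1.
    - by rewrite -[c](conjgKV b) -conjRg Ca ?conj1g //; apply: normalJ.
  apply: (Wx _ nC) h Hh => _ [y _ <-] h Hh.
  have -> : [~ h, word_eval w y] = (word_eval w y ^ h)^-1 * word_eval w y.
    by group_norm.
  rewrite -eval_conj (shift _ y) ?mulVg // => i.
  have -> : y i ^ h / y i = [~ h, (y i)^-1] by group_norm.
  exact: normal_comm_sub.
have [D [nD finD WD]] := schur nH fH nW HW.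
have [d dW] := derived_sub_verbal G mw.
have fin_d : in_finite_normal (@derived G d.+1).
  exists D; split=> // z; apply=> // _ [a da [b db <-]]; apply: WD.
  by exists a; [apply: dW | exists b => //; apply: dW].
have [N [nN finN VN]] :=
  finite_restricted_values mw nH fH wH finw fin_d (fun=> 0%N).
by exists N; split=> // _ [x _ <-]; apply: VN; exists x.
Qed.

End MarginalSubgroup.

(** * Clopen sets in compact spaces, and open normal subgroups *)

Section Profinite.

(** The complement of [W] is compact, so finitely many separating clopen sets suffice and their
    intersection is the desired one. The filter generated by the clopen sets around [x] expresses
    this as a near-covering. *)
Lemma clopen_sub_of_separated (T : topologicalType) (x : T) (W : set T) :
  compact [set: T] -> open W ->
  (forall y, ~ W y -> exists C, [/\ clopen C, C x & ~ C y]) ->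
  exists C, [/\ clopen C, C x & C `<=` W].
Proof.
move=> cT oW sep.
pose F := filter_from [set C : set T | C x /\ clopen C] id.
have FF : Filter F.
  apply: filter_from_filter; first by exists setT; split=> //; apply: clopenT.
  by move=> A B [? ?] [? ?]; exists (A `&` B) => //; split=> //; apply: clopenI.
have PF : ProperFilter F by apply: filter_from_proper => C [? _]; exists x.
have /compact_near_coveringP/(_ _ _ setC (powerset_filter_from_filter PF))[] :
    compact (~` W).
  by apply: (subclosed_compact _ cT) => //; apply: open_closedC.
  move=> y /sep[C [[oC cC] Cx Cy]]; exists (~` C, [set U | U `<=` C]).
    split; first by apply: open_nbhs_nbhs; split=> //; apply: closed_openC.
    apply/near_powerset_filter_fromP; first by move=> ? ?; apply: subset_trans.
    by exists C => //; exists C.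
  by case=> i j [? /subsetC]; apply.
move=> D [DF _ [C DC]] /(_ _ DC)/subsetC2 CW.
by have [B [Bx cB] BC] := DF _ DC; exists B; split=> //; apply: subset_trans CW.
Qed.

(* In a compact Hausdorff space the intersection of the clopen sets that contain
   a point is connected. *)
Lemma compact_zero_dimensional (T : topologicalType) :
  compact [set: T] -> hausdorff_space T -> totally_disconnected [set: T] ->
  zero_dimensional T.
Proof.
move=> cT hT tdT x y xy.
pose Q := [set z | forall C, clopen C -> C x -> C z].
have Qx : Q x by move=> C _.
suff Qconn : connected Q.
  have nQy : ~ Q y.
    move=> Qy; have : connected_component setT x y by exists Q.
    by rewrite tdT // => yx; rewrite yx eqxx in xy.
  have [C /not_implyP[cC /not_implyP[Cx nCy]]] := (existsNP _).2 nQy.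
  by exists C.
have cQ : closed Q.
  rewrite (_ : Q = \bigcap_(C in [set C | clopen C /\ C x]) C).
    by apply: closed_bigI => C [[]].
  by apply/seteqP; split=> z Qz C => [[cC Cx]|cC Cx]; apply: Qz.
move=> B [b Bb] [O oO BO] [C cC BC].
have cB : closed B by rewrite BC; apply: closedI.
pose A := Q `&` ~` O.
have cA : closed A by apply: closedI => //; apply: open_closedC.
have nTA : set_nbhs B (~` A).
  apply/set_nbhsP; exists (~` A); split=> //; first exact: closed_openC.
  by move=> z; rewrite BO => -[_ Oz] [_].
have [V /set_nbhsP[U [oU BU UV]] VA] := compact_normal hT cT cB nTA.
have oV : open (~` closure V) by apply: closed_openC; apply: closed_closure.
have disj z : U z -> ~ (~` closure V) z.
  by move=> Uz; apply; apply: subset_closure; apply: UV.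
have [D [[oD cD] Dx DUV]] : exists D,
    [/\ clopen D, D x & D `<=` U `|` ~` closure V].
  apply: clopen_sub_of_separated => // [|z nUVz]; first exact: openU.
  have nQz : ~ Q z.
    move=> Qz; apply: nUVz; have [Oz|nOz] := pselect (O z).
      by left; apply: BU; rewrite BO.
    by right=> /VA; apply.
  have [D /not_implyP[cD /not_implyP[Dx nDz]]] := (existsNP _).2 nQz.
  by exists D.
have clD1 : clopen (D `&` U).
  split; first exact: openI.
  rewrite (_ : D `&` U = D `&` closure V).
    by apply: closedI => //; apply: closed_closure.
  apply/seteqP; split=> z [Dz Uz]; split=> //.
    by apply: subset_closure; apply: UV.
  by have [|] := DUV z Dz.
have clD2 : clopen (D `&` ~` closure V).
  split; first exact: openI.
  rewrite (_ : D `&` ~` closure V = D `&` ~` U).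
    by apply: closedI => //; apply: open_closedC.
  apply/seteqP; split=> z [Dz Uz]; split=> //; first by move=> /disj.
  by have [|] := DUV z Dz.
have BQ : B `<=` Q by rewrite BO => z [].
apply/seteqP; split=> // z Qz.
(* Of the two clopen halves of [D], the one that contains [x] contains all of [Q]. If it is the half
   in [U], then [A] is empty; otherwise [b] would be outside [U]. *)
have [Ox|nOx] := pselect (O x).
  have Ux : U x by apply: BU; rewrite BO.
  have [Dz Uz] : (D `&` U) z by apply: Qz.
  rewrite BO; split=> //; apply: contrapT => nOz.
  apply: (VA z) => //; apply: subset_closure; exact: UV.
exfalso; have : (D `&` ~` closure V) b.
  by apply: (BQ b Bb) => //; split=> // /VA; apply.
by move=> [_]; apply: disj; apply: BU.
Qed.

Variable G : topologicalGroupType.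
Implicit Types (N H K U : set G).

Lemma cvg_mulg T (F : set_system T) (f g : T -> G) (a b : G) : Filter F ->
  f @ F --> a -> g @ F --> b -> (fun t => f t * g t) @ F --> a * b.
Proof.
move=> FF fa gb.
exact: (cvg_comp _ _ (cvg_pair fa gb) (mulg_continuous (a, b))).
Qed.

(** For a subgroup, being a neighbourhood of 1 amounts to being open. *)
Definition open_normal N := normal N /\ nbhs (1 : G) N.

Lemma open_normalI N H :
  open_normal N -> open_normal H -> open_normal (N `&` H).
Proof.
by move=> [nN oN] [nH oH]; split; [apply: nsubI | apply: filterI].
Qed.

Lemma open_normal_bigI (I : finType) (N : I -> set G) :
  (forall i, open_normal (N i)) -> open_normal (\bigcap_i N i).
Proof.
move=> oN.
have -> : \bigcap_i N i = [set z | forall i, i \in enum I -> N i z].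
  by apply/seteqP; split=> z Nz i => [_|_]; apply: Nz; rewrite ?mem_enum.
elim: (enum I) => [|i s IH].
  rewrite (_ : [set z | _] = setT); last by apply/seteqP; split.
  by split; [apply: normalT | apply: filterT].
rewrite (_ : [set z | _] = N i `&` [set z | forall i, i \in s -> N i z]).
  exact: open_normalI.
apply/seteqP; split=> [z Nz|z [Niz Nz] j].
  by split=> [|j js]; apply: Nz; rewrite inE ?eqxx // js orbT.
by rewrite inE => /orP[/eqP ->|/Nz].
Qed.

Lemma nbhs_coset N x : open_normal N -> nbhs x [set y | N (y / x)].
Proof.
move=> [_ oN].
have : (fun y => y / x) @ x --> x / x.
  by apply: cvg_mulg; [apply: cvg_id | apply: cvg_cst].
by rewrite mulgV => /(_ _ oN).
Qed.

Hypothesis G_profinite : profinite G.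

Lemma open_normal_finite_index N : open_normal N -> finite_index N.
Proof.
move=> oN; have [cG _ _] := G_profinite.
(* Along this filter a sequence eventually contains any given elements; compactness then yields one
   sequence that works for all [x]. *)
pose F := filter_from [set: seq G] (fun s =>
  [set s' : seq G | {subset s <= s'}]).
have FF : Filter F.
  apply: filter_from_filter; first by exists [::].
  move=> s t _ _; exists (s ++ t) => // r str.
  by split=> z zs; apply: str; rewrite mem_cat zs ?orbT.
have := (compact_near_coveringP _).1 cG _ F
  (fun s x => exists2 a, a \in s & N (x / a)) FF.
case=> [x _|s _ /(_ s (fun z zs => zs)) sN]; last by exists s => x; apply: sN.
exists ([set y | N (y / x)], [set s | x \in s]).
  split; first exact: nbhs_coset.
  by exists [:: x] => // s; apply; rewrite inE.
by move=> [y s] [/= Ny xs]; exists x.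
Qed.

(** Take a clopen [U] that contains 1 but not [g]. The elements whose insertion into a product never
    affects its membership in [U] form a normal subgroup, and compactness of [G * G] makes it a
    neighbourhood of 1. *)
Lemma open_normal_separated (g : G) :
  g <> 1 -> exists2 N, open_normal N & ~ N g.
Proof.
move=> /eqP g1; have [cG hG tG] := G_profinite.
have g1' : 1 != g by rewrite eq_sym.
have [U [[oU cU] U1 nUg]] := compact_zero_dimensional cG hG tG g1'.
exists [set g | forall x y, U (x * g * y) <-> U (x * y)]; last first.
  by move=> /(_ 1 1) [_]; rewrite !mul1g !mulg1 => /(_ U1).
split.
  split=> [x y|h1 h2 N1 N2 x y|h Nh x y|h k Nh _ x y] /=.
  - by rewrite mulg1.
  - have := N1 x (h2 * y); have := N2 x y; rewrite !mulgA.
    by move=> [? ?] [? ?]; split; auto.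
  - by have := Nh (x / h) y; rewrite mulgVK => -[? ?]; split.
  - have := Nh (x / k) (k * y).
    have -> : x * h ^ k * y = x / k * h * (k * y) by group_norm.
    by have -> : x / k * (k * y) = x * y by group_norm.
have near_inv V x y : open V -> V (x * y) ->
    \forall p \near (x, y) & g \near (1 : G),
      V (p.1 * g * p.2) /\ V (p.1 * p.2).
  move=> oV Vxy; pose F := filter_prod (nbhs (x, y)) (nbhs (1 : G)).
  have nV : nbhs (x * y) V by apply: open_nbhs_nbhs.
  have c1 : (fun q : (G * G) * G => q.1.1) @ F --> x.
    exact: (cvg_comp _ _ cvg_fst (cvg_fst (F := nbhs x) (G := nbhs y))).
  have c2 : (fun q : (G * G) * G => q.1.2) @ F --> y.
    exact: (cvg_comp _ _ cvg_fst (cvg_snd (F := nbhs x) (G := nbhs y))).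
  have c3 : (fun q : (G * G) * G => q.2) @ F --> (1 : G) by exact: cvg_snd.
  have c13 : (fun q : (G * G) * G => q.1.1 * q.2 * q.1.2) @ F --> x * y.
    by rewrite -[x in x * y]mulg1; apply: cvg_mulg => //; apply: cvg_mulg.
  have c12 : (fun q : (G * G) * G => q.1.1 * q.1.2) @ F --> x * y.
    exact: cvg_mulg.
  exact: (@filterI _ F _ _ _ (c13 _ nV) (c12 _ nV)).
have := (compact_near_coveringP _).1 (compact_setX cG cG) G (nbhs (1 : G))
  (fun g p => U (p.1 * g * p.2) <-> U (p.1 * p.2)) (nbhs_filter _).
move=> near_cov; apply: (filterS _ (near_cov _)) => [h Uh x y|[x y] _].
  exact: (Uh (x, y)).
have [Uxy|nUxy] := pselect (U (x * y)).
  by apply: filterS (near_inv U x y oU Uxy) => -[p h] [].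
have oU' : open (~` U) by apply: closed_openC.
by apply: filterS (near_inv (~` U) x y oU' nUxy) => -[p h] [].
Qed.

(** A cluster point of [a] works: the coset of [K k] through [a k] contains all later terms, and it
    is closed because its fellow cosets are open. *)
Lemma nested_cosets (a : nat -> G) (K : nat -> set G) :
  (forall k, open_normal (K k)) -> (forall k, K k.+1 `<=` K k) ->
  (forall k, K k (a k.+1 / a k)) -> exists x, forall k, K k (x / a k).
Proof.
move=> oK Kdecr aK; have [cG _ _] := G_profinite.
have [x [_ xa]] := cG (a @ \oo) _ filterT.
exists x => k; have [nK _] := oK k.
have KA : (a @ \oo) [set y | K k (y / a k)].
  exists k => // l /= kl; rewrite -(subnK kl).
  elim: (l - k)%N => [|m IH]; first by rewrite add0n mulgV; apply: nsub1 nK.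
  rewrite addSn -(divgKA (a (m + k)%N)); apply: (nsubM nK) => //.
  have : K (m + k)%N `<=` K k.
    elim: m {IH} => [|m IH] //; apply: subset_trans IH; exact: Kdecr.
  by apply; apply: aK.
have [y [/= Ky Kyx]] := xa _ _ KA (nbhs_coset x (oK k)).
rewrite -(divgKA y); apply: (nsubM nK) => //.
by rewrite -invgF; apply: (nsubV nK).
Qed.

End Profinite.

(** * From countably many values to an open subgroup on which [w] is trivial *)

Section VerbalSubgroup.
Variables (n : nat) (G : topologicalGroupType).
Hypothesis G_profinite : profinite G.
Variable w : word n.
Hypotheses (mw : multilinear_commutator w)
  (w_countable : countable (word_values G w)).
Implicit Types (a b x : 'I_n -> G) (H K N : set G).

(* Baire category argument: otherwise one finds nested boxes avoiding the
   countably many values one after the other, and a point in all of them. *)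
Lemma constant_box a H : open_normal H ->
  exists b K, [/\ open_normal K, K `<=` H, box H a b &
    forall c, box K b c -> word_eval w c = word_eval w b].
Proof.
move=> oH; have /countable_injP[f f_inj] := w_countable.
have mem_val c : word_eval w c \in word_values G w by apply/mem_set; exists c.
apply: contrapT => none.
pose valid (q : ('I_n -> G) * set G) :=
  [/\ open_normal q.2, q.2 `<=` H & box H a q.1].
(* Stage [k] passes to a smaller box on which the value with code [k] is not taken. Invalid input
   gets a dummy answer. *)
have /choice[step stepP] (p : nat * (('I_n -> G) * set G)) : exists q,
    valid p.2 -> [/\ valid q, q.2 `<=` p.2.2, box p.2.2 p.2.1 q.1 &
      forall c, box q.2 q.1 c -> f (word_eval w c) <> p.1].
  case: p => k [b K] /=.
  have [[oK KH ab]|nv] := pselect (valid (b, K)); last by exists (b, K).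
  have [nK _] := oK.
  have [[c0 bc0 fk]|nk] := pselect
    (exists2 c, box K b c & f (word_eval w c) = k); last first.
    exists (b, K) => _; split=> //; first exact: box_refl.
    by move=> c bc fk; apply: nk; exists c.
  have [b' bb' wb'] : exists2 b', box K b b' & word_eval w b' <> word_eval w c0.
    apply: contrapT => nb'; apply: none; exists b, K; split=> // c bc.
    have const d : box K b d -> word_eval w d = word_eval w c0.
      by move=> bd; apply: contrapT => wd; apply: nb'; exists d.
    by rewrite !const //; apply: box_refl.
  (* On the cosets of [N] through [b'], the values are congruent to that at [b'] modulo [N], so none
     equals that at [c0]. *)
  have [|N oN nN] := open_normal_separated G_profinite
      (g := word_eval w c0 / word_eval w b').
    by move=> /divg1_eq e; apply: wb'.
  exists (b', K `&` N) => _; split=> /=; last first.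
  - move=> c bc fc; apply: nN.
    have <- : word_eval w c = word_eval w c0 by apply: f_inj; rewrite ?fc.
    by apply: eval_congr => [|i]; [case: oN | case: (bc i)].
  - exact: bb'.
  - by move=> z [].
  - split=> /=; [exact: open_normalI | by move=> z [/KH] |].
    move=> i; rewrite -(divgKA (b i)); have [nH _] := oH.
    by apply: (nsubM nH); [apply/KH/bb' | apply: ab].
pose fix st k := if k is k'.+1 then step (k', st k') else (a, H).
have stV k : valid (st k).
  elim: k => [|k IH]; first by split=> //; apply: box_refl; case: oH.
  by have [] := stepP (k, st k) IH.
have /choice[x xst] i : exists xi, forall k, (st k).2 (xi / (st k).1 i).
  apply: (nested_cosets G_profinite (a := fun k => (st k).1 i)
    (K := fun k => (st k).2)) => k; first by have [] := stV k.
    by have [] := stepP (k, st k) (stV k).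
  by have [_ _ ab _] := stepP (k, st k) (stV k); apply: ab.
(* The value at [x] was excluded at the stage given by its own code. *)
pose k := f (word_eval w x).
have [_ _ _ /(_ x)] := stepP (k, st k) (stV k).
by apply=> // i; apply: (xst i k.+1).
Qed.

(** Induction on the number of letters outside [I] gives an [H] for which [w] vanishes once the
    letters of [I] and one further letter lie in [H]. With the letters of [I] in [H], the other
    letters then matter only modulo [H], and each of the finitely many tuples of cosets is settled
    by a constant box. *)
Lemma trivial_on_open_normal (I : {set 'I_n}) :
  (exists2 i, i \in I & involves w i) ->
  exists2 H, open_normal H &
    forall x, (forall i, i \in I -> H (x i)) -> word_eval w x = 1.
Proof.
have [r] := ubnP #|~: I|; elim: r I => // r IH I; rewrite ltnS => Ir wI.
have /choice[Hi HiP] i : exists H, open_normal H /\ (i \notin I -> forall x,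
    (forall j, j \in i |: I -> H (x j)) -> word_eval w x = 1).
  case: (boolP (i \in I)) => [iI|iI].
    by exists setT; split=> //; split; [apply: normalT | apply: filterT].
  have [||H oH HP] := IH (i |: I).
  - apply: leq_trans Ir; apply: proper_card; rewrite properC.
    apply/properP; split; first exact: finset.subsetUr.
    by exists i; rewrite ?setU11.
  - by case: wI => j jI wj; exists j; rewrite // !inE jI orbT.
  - by exists H.
pose H := \bigcap_i Hi i.
have oH : open_normal H.
  by apply: open_normal_bigI => i; case: (HiP i).
have [nH _] := oH.
have [s sH] := open_normal_finite_index G_profinite oH.
(* The entry 1 at the letters of [I] forces [b i] into [H] there, as [eval_in_variation]
   requires. *)
pose a (c : {ffun 'I_n -> seq_sub s}) j := if j \in I then 1 else val (c j).
have /choice[Kc KcP] c : exists K, open_normal K /\ forall x,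
    (forall j, j \in I -> K (x j)) ->
    (forall j, j \notin I -> H (x j / a c j)) -> word_eval w x = 1.
  have [b [K [oK KH ab wb]]] := constant_box (a c) oH.
  have [nK _] := oK.
  have Hb i : i \in I -> H (b i).
    by move=> iI; have := ab i; rewrite /a iI divg1.
  have [b' bb' wb'] := eval_in_variation nH nK mw wI Hb.
  exists K; split=> // x Kx xa.
  pose x' j := if j \in I then x j else b' j.
  have wx' : word_eval w x' = 1.
    have : ncl K (variation K w b) (word_eval w x').
      by apply: wb' => i _ iI; rewrite /x' ?(negPf iI) // iI; apply: Kx.
    move=> /(_ [set 1]); apply; first exact/normal_normalized/normal1.
    by move=> _ [c1 /wb -> [c2 /wb -> <-]]; rewrite mulgV.
  rewrite -wx'; apply: divg1_eq.
  (* The tuples [x] and [x'] agree on [I], so [B] is empty there; elsewhere they are congruent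
     modulo [H], and changes by [H] are harmless by induction. *)
  pose S j : set G := if j \in I then H else setT.
  pose B j : set G := if j \in I then set0 else H.
  apply: (@eval_shift _ _ w S B) (normal1 G) _ _ _ _ _ _ => //.
  - by move=> j y z; rewrite /S; case: ifP => // _; apply: normalJ.
  - by move=> j y z; rewrite /B; case: ifP => // _; apply: normalJ.
  - move=> i wi _ [z Sz <-]; case: (boolP (i \in I)) => iI.
      by have := Sz i; rewrite upd_same /B iI.
    have [_ /(_ iI)] := HiP i; apply=> j.
    have : H `<=` Hi i by move=> t; apply.
    move=> HHi; rewrite !inE => jI; apply: HHi.
    have := Sz j; rewrite /upd /S /B; case: eqP jI => [-> _|_ /= -> //].
    by rewrite (negPf iI).
  - by move=> j; rewrite /S /x'; case: ifP => // jI; apply/KH/Kx.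
  - by move=> j; rewrite /S; case: ifP => // jI; apply/KH/Kx.
  move=> j _; rewrite /x' /B; case: ifPn => jI; [by left | right].
  have [h Hh ->] := bb' j.
  (* Modulo [H], the elements [x j], [a c j], [b j] and [b j ^ h] coincide. *)
  have -> : x j / b j ^ h =
      (x j / a c j) * ((b j / a c j)^-1 * [~ (b j)^-1, h]).
    by group_norm.
  apply: (nsubM nH); first exact: xa.
  apply: (nsubM nH); first exact: (nsubV nH).
  rewrite -invgR; apply: (nsubV nH).
  exact: (normal_comm_sub _ nH Hh).
exists (\bigcap_c Kc c).
  by apply: open_normal_bigI => c; case: (KcP c).
move=> x Kx.
have /choice[c xc] i : exists c : seq_sub s, H (x i / val c).
  by have [z zs Hz] := sH (x i); exists (SeqSub zs).
have [_] := KcP (finfun c); apply=> j jI; first exact: Kx.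
by rewrite /a (negPf jI) ffunE.
Qed.

Lemma values_in_finite_normal : in_finite_normal (word_values G w).
Proof.
have /choice[Hi HiP] i : exists H, open_normal H /\ (involves w i ->
    forall x, H (x i) -> word_eval w x = 1).
  case: (boolP (involves w i)) => wi; last first.
    by exists setT; split=> //; split; [apply: normalT | apply: filterT].
  have [|H oH HP] := trivial_on_open_normal (I := [set i]).
    by exists i; rewrite ?inE.
  by exists H; split=> // _ x Hx; apply: HP => j; rewrite inE => /eqP ->.
have oH : open_normal (\bigcap_i Hi i).
  by apply: open_normal_bigI => i; case: (HiP i).
apply: marginal_finite_verbal (oH.1) _ _ => //.
  exact: open_normal_finite_index.
by move=> i x wi Hx; have [_ /(_ wi)] := HiP i; apply; apply: Hx.
Qed.

End VerbalSubgroup.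

Theorem theorem1p1 (n : nat) (w : word n) (G : topologicalGroupType)
    (w_mlc : multilinear_commutator w) (G_profinite : profinite G)
    (w_countable : countable (word_values G w)) :
  finite_set (verbal_subgroup G w).
Proof.
have [N [nN finN wN]] := values_in_finite_normal G_profinite w_mlc w_countable.
(* A finite set is closed in a Hausdorff space, so [N] is among the closed subgroups whose
   intersection is [w(G)]. *)
apply: sub_finite_set (finN) => z; apply; split=> //; split.
  have [_ hG _] := G_profinite.
  exact: (accessible_finite_set_closed.1 (hausdorff_accessible hG) _ finN).
split=> [|x y]; first by apply/mem_set; apply: nsub1 nN.
move=> /set_mem Nx /set_mem Ny; apply/mem_set.
by apply: (nsubM nN) => //; apply: (nsubV nN).
Qed.
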